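(* Let $(F,f)$ be a morphism of Chern-Weil triples from $(A,\Phi,C)$ to $(B,\Psi,D)$ such that $F_k$ vanishes for all even $k$. Then for every $n\geq 1$ $$f(\mathcal C_n^A)=\mathcal C_n^B .$$
   Context: Graded vector spaces are non-negatively graded over $\mathbf k\in\{\mathbb R,\mathbb C\}$; differentials have degree $1$; the Koszul sign rule is used. A curved $A_\infty$-algebra is a graded vector space $A$ with linear maps $m_k:A^{\otimes k}\to A$ of degree $2-k$, $k\ge0$, such that $\sum_{r+s+t=n}(-1)^{r+st}m_{r+t+1}(\mathbf 1^{\otimes r}\otimes m_s\otimes\mathbf 1^{\otimes t})=0$ for all $n\ge0$; $m_0$ also denotes $m_0(1)\in A_2$. A morphism $F:A\to B$ of curved $A_\infty$-algebras is a family of linear maps $F_k:A^{\otimes k}\to B$ of degree $1-k$, $k\ge1$ ($F_0=0$), with $F_1m_0^A=m_0^B$ and for every $n>0$ $$\sum_{r+s+t=n}(-1)^{r+st}F_{r+t+1}(\mathbf 1^{\otimes r}\otimes m_s^A\otimes\mathbf 1^{\otimes t})=\sum_{1\le q\le n}\ \sum_{i_1+\dots+i_q=n}(-1)^w m_q^B(F_{i_1}\otimes\dots\otimes F_{i_q}),\quad w=\sum_{\ell=1}^{q-1}(q-\ell)(i_\ell-1).$$ A Chern-Weil triple $(A,\Phi,C)$ consists of a curved $A_\infty$-algebra $A$, a chain complex $(C,d)$ and a degree-zero linear map $\Phi:A\to C$ with (i) $\Phi(m_1(x))=d\Phi(x)$ for all even-degree $x\in A$; (ii) $\sum_{\sigma\in\mathbf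 S_n}\Phi(m_n(x_{\sigma(1)},\dots,x_{\sigma(n)}))=0$ for all odd $n>1$ and even-degree $x_1,\dots,x_n\in A$. A morphism of Chern-Weil triples $(A,\Phi,C)\to(B,\Psi,D)$ is a pair $(F,f)$, with $F:A\to B$ a morphism of curved $A_\infty$-algebras and $f:C\to D$ a chain map, such that (i) $\Psi(F_1(x))=f(\Phi(x))$ for all even-degree $x\in A$; (ii) $\sum_{\sigma\in\mathbf S_n}\Psi(F_n(x_{\sigma(1)},\dots,x_{\sigma(n)}))=0$ for all odd $n>1$ and even-degree $x_1,\dots,x_n\in A$. For a rooted planar tree $\mathcal T$ (valency of a vertex = number of outgoing edges, directed away from the root), $\mathcal M_{\mathcal T}\in A$ is obtained by assigning $m_k$ to each vertex of valency $k$ and composing (vertices of valency $0$ give $m_0$). The degree of $\mathcal T$ is the degree of $\mathcal M_{\mathcal T}$, i.e. $1+$ number of vertices. $\mathrm{C.E.T.}(2n)$ is the set of rooted planar trees of degree $2n$ all of whose vertices have even valency. For the triple $(A,\Phi,C)$, $\mathcal C_n^A=\sum_{\mathcal T\in\mathrm{C.E.T.}(2n)}\Phi(\mathcal M_{\mathcal T})\in C^{2n}$, and $\mathcal C_n^B\in D^{2n}$ is defined likewise from $(B,\Psi,D)$. *)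

(* Defs.v *)
From HB Require Import structures.
From mathcomp Require Import all_boot all_order all_algebra all_fingroup.
From mathcomp Require Import boolp classical_sets functions cardinality fsbigop.
From mathcomp Require Import reals.
From mathcomp Require Import complex.

Set Implicit Arguments.
Unset Strict Implicit.
Unset Printing Implicit Defensive.

Import Order.TTheory GRing.Theory Num.Theory.
Local Open Scope classical_set_scope.
Local Open Scope ring_scope.

Inductive scalars := RealScalars | ComplexScalars.

Definition ground_field (R : realType) (k : scalars) : fieldType :=
  match k with
  | RealScalars => R
  | ComplexScalars => R[i]
  end.

(* A graded vector space is given by its total space together with the
   homogeneous components, of which it is the internal direct sum. *)
Record gradedVect (K : fieldType) := GradedVect {
  gv_space :> lmodType K;
  gv_deg : nat -> set gv_space;
  gv_deg0 : forall i, gv_deg i 0;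
  gv_degP : forall i (a : K) x y,
    gv_deg i x -> gv_deg i y -> gv_deg i (a *: x + y);
  gv_span : forall x, exists N (y : nat -> gv_space),
    (forall i, gv_deg i (y i)) /\ x = \sum_(i < N) y i;
  gv_direct : forall N (y : nat -> gv_space),
    (forall i, gv_deg i (y i)) -> \sum_(i < N) y i = 0 ->
    forall i, (i < N)%N -> y i = 0
}.

(* The grading extended by zero to negative degrees. *)
Definition gv_degz (K : fieldType) (V : gradedVect K) (i : int) : set V :=
  match i with
  | Posz n => @gv_deg K V n
  | Negz _ => [set 0]
  end.

Definition even_deg (K : fieldType) (V : gradedVect K) (x : V) : Prop :=
  exists i : nat, gv_deg (2 * i) x.

Fixpoint homogeneous (K : fieldType) (V : gradedVect K)
    (ds : seq nat) (xs : seq V) : Prop :=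
  match ds, xs with
  | [::], [::] => True
  | d :: ds', x :: xs' => gv_deg d x /\ homogeneous ds' xs'
  | _, _ => False
  end.

(* A family of linear maps V^{(x)k} -> W, k >= 0, i.e. of k-linear maps
   V^k -> W, is encoded as a single function on sequences: its k-th member is
   the restriction to the sequences of size k. *)
Definition multilinear (K : fieldType) (V W : lmodType K) (g : seq V -> W) :=
  forall (s t : seq V) (a : K) (x y : V),
    g (s ++ (a *: x + y) :: t) = a *: g (s ++ x :: t) + g (s ++ y :: t).

(* The k-th member of the family has degree c - k. *)
Definition family_degree (K : fieldType) (V W : gradedVect K) (c : int)
    (g : seq V -> W) :=
  forall ds (xs : seq V), homogeneous ds xs ->
    gv_degz ((sumn ds)%:Z + (c - (size xs)%:Z)) (g xs).

(* x_1, ..., x_r, m_s (x_{r+1}, ..., x_{r+s}), x_{r+s+1}, ..., x_n *)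
Definition insert_op (V : Type) (m : seq V -> V) (r s : nat) (xs : seq V) :=
  take r xs ++ m (take s (drop r xs)) :: drop (r + s) xs.

(* sum_{r+s+t=n} (-1)^{r+st} g_{r+t+1} (1^{(x)r} (x) m_s (x) 1^{(x)t})
   at x_1 (x) ... (x) x_n, the x_i being homogeneous of degrees ds.  The second
   sign is the Koszul sign: m_s, of degree 2 - s, goes past x_1, ..., x_r. *)
Definition stasheff_sum (K : fieldType) (V W : lmodType K)
    (g : seq V -> W) (m : seq V -> V) (ds : seq nat) (xs : seq V) : W :=
  let n := size xs in
  \sum_(0 <= r < n.+1) \sum_(0 <= s < (n - r).+1)
    let t := (n - r - s)%N in
    ((-1) ^+ (r + s * t) * (-1) ^+ (s * sumn (take r ds)))
      *: g (insert_op m r s xs).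

(* sum_{1<=q<=n} sum_{i_1+...+i_q=n} (-1)^w m_q (F_{i_1} (x) ... (x) F_{i_q})
   at x_1 (x) ... (x) x_n, the x_i being homogeneous of degrees ds.  The second
   sign is the Koszul sign: each F_{i_l}, of degree 1 - i_l, goes past
   x_1, ..., x_{i_1+...+i_{l-1}}. *)
Definition composition_weight (i : seq nat) : nat :=
  \sum_(1 <= l < size i) (size i - l) * (nth 0 i l.-1 - 1).

Definition composition_koszul (i ds : seq nat) : nat :=
  \sum_(1 <= l < (size i).+1)
    (nth 0 i l.-1 - 1) * sumn (take (sumn (take l.-1 i)) ds).

Definition composition_sum (K : fieldType) (V W : lmodType K)
    (m : seq W -> W) (F : seq V -> W) (ds : seq nat) (xs : seq V) : W :=
  let n := size xs in
  \sum_(1 <= q < n.+1)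
    \sum_(i : q.-tuple 'I_n.+1 |
          all (leq 1) (map val i) && (sumn (map val i) == n))
      ((-1) ^+ composition_weight (map val i)
         * (-1) ^+ composition_koszul (map val i) ds)
        *: m (map F (reshape (map val i) xs)).

Record curvedAinf (K : fieldType) := CurvedAinf {
  ca_space :> gradedVect K;
  ca_m : seq ca_space -> ca_space;
  ca_linear : multilinear ca_m;
  ca_degree : family_degree 2 ca_m;
  ca_stasheff : forall ds xs, homogeneous ds xs ->
    stasheff_sum ca_m ca_m ds xs = 0
}.

Record ainfMorphism (K : fieldType) (A B : curvedAinf K) := AinfMorphism {
  am_F :> seq A -> B;
  am_F0 : am_F [::] = 0;
  am_linear : multilinear am_F;
  am_degree : family_degree 1 am_F;
  am_curvature : am_F [:: ca_m (c := A) [::]] = ca_m (c := B) [::];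
  am_stasheff : forall ds xs, (0 < size xs)%N -> homogeneous ds xs ->
    stasheff_sum am_F (ca_m (c := A)) ds xs =
    composition_sum (ca_m (c := B)) am_F ds xs
}.

Record cochainComplex (K : fieldType) := CochainComplex {
  cc_space :> gradedVect K;
  cc_d : {linear cc_space -> cc_space};
  cc_degree : forall i x, gv_deg i x -> gv_deg i.+1 (cc_d x);
  cc_dd : forall x, cc_d (cc_d x) = 0
}.

Record chainMap (K : fieldType) (C D : cochainComplex K) := ChainMap {
  cm_map :> {linear C -> D};
  cm_degree : forall i x, gv_deg i x -> gv_deg i (cm_map x);
  cm_d : forall x, cm_map (cc_d C x) = cc_d D (cm_map x)
}.

(* The vanishing, for odd n > 1 and even-degree x_1, ..., x_n, of
   sum_sigma Phi (g_n (x_sigma(1), ..., x_sigma(n))). *)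
Definition odd_symmetrization_vanishes (K : fieldType) (V : gradedVect K)
    (W Z : lmodType K) (Phi : W -> Z) (g : seq V -> W) :=
  forall (n : nat) (x : 'I_n -> V), odd n -> (1 < n)%N ->
    (forall i, even_deg (x i)) ->
    \sum_(sigma : 'S_n) Phi (g [seq x (sigma i) | i <- enum 'I_n]) = 0.

Record chernWeil (K : fieldType) := ChernWeil {
  cw_alg : curvedAinf K;
  cw_cpx : cochainComplex K;
  cw_Phi : {linear cw_alg -> cw_cpx};
  cw_degree : forall i x, gv_deg i x -> gv_deg i (cw_Phi x);
  cw_m1 : forall x, even_deg x ->
    cw_Phi (ca_m [:: x]) = cc_d cw_cpx (cw_Phi x);
  cw_sym : odd_symmetrization_vanishes cw_Phi (ca_m (c := cw_alg))
}.

Record cwMorphism (K : fieldType) (X Y : chernWeil K) := CwMorphism {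
  cwm_F : ainfMorphism (cw_alg X) (cw_alg Y);
  cwm_f : chainMap (cw_cpx X) (cw_cpx Y);
  cwm_F1 : forall x, even_deg x ->
    cw_Phi Y (cwm_F [:: x]) = cwm_f (cw_Phi X x);
  cwm_sym : odd_symmetrization_vanishes (cw_Phi Y) cwm_F
}.

Inductive planarTree := Node of seq planarTree.

Section PlanarTreeChoice.

Fixpoint tree_encode (T : planarTree) : GenTree.tree unit :=
  let: Node Ts := T in GenTree.Node 0 (map tree_encode Ts).

Fixpoint tree_decode (T : GenTree.tree unit) : planarTree :=
  match T with
  | GenTree.Leaf _ => Node [::]
  | GenTree.Node _ Ts => Node (map tree_decode Ts)
  end.

Lemma tree_encodeK : cancel tree_encode tree_decode.
Proof.
rewrite /cancel; fix IH 1; case=> Ts /=; congr Node.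
by elim: Ts => //= T Ts ->; rewrite IH.
Qed.

End PlanarTreeChoice.

HB.instance Definition _ := Countable.copy planarTree (can_type tree_encodeK).

Fixpoint tree_vertices (T : planarTree) : nat :=
  let: Node Ts := T in (sumn (map tree_vertices Ts)).+1.

Definition tree_degree (T : planarTree) : nat := (tree_vertices T).+1.

Fixpoint even_valencies (T : planarTree) : bool :=
  let: Node Ts := T in ~~ odd (size Ts) && all even_valencies Ts.

Definition CET (n : nat) : set planarTree :=
  [set T | even_valencies T /\ tree_degree T = n].

Fixpoint tree_op (V : Type) (m : seq V -> V) (T : planarTree) : V :=
  let: Node Ts := T in m (map (tree_op m) Ts).

Fixpoint seqs_upto (T : Type) (k : nat) (l : seq T) : seq (seq T) :=
  if k is k'.+1 then
    [::] :: [seq x :: s | x <- l, s <- seqs_upto k' l]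
  else [:: [::]].

Fixpoint trees_upto (n : nat) : seq planarTree :=
  if n is n'.+1 then map Node (seqs_upto n' (trees_upto n')) else [::].

Lemma mem_seqs_upto (T : eqType) k (l s : seq T) :
  (size s <= k)%N -> {subset s <= l} -> s \in seqs_upto k l.
Proof.
elim: k s => [|k IH] [|x s] //= sk sl; rewrite inE /=.
apply/allpairsP; exists (x, s); split=> //=; first by apply: sl; rewrite mem_head.
by apply: IH => // y ys; apply: sl; rewrite inE ys orbT.
Qed.

Lemma mem_trees_upto n T : (tree_vertices T <= n)%N -> T \in trees_upto n.
Proof.
elim: n T => [|n IH] [Ts] //=; rewrite ltnS => le_n.
apply/map_f/mem_seqs_upto.
  apply: leq_trans le_n; elim: Ts => //= -[Us] Ts IHs /=.
  by rewrite addSn ltnS (leq_trans IHs) // leq_addl.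
move=> T TTs; apply: IH; apply: leq_trans le_n.
elim: Ts TTs => //= U Ts IHs; rewrite inE => /predU1P[->|/IHs le_s].
  exact: leq_addr.
exact: leq_trans le_s (leq_addl _ _).
Qed.

(* The sum over CET (2 * n) below is a finitely supported sum, which would be 0
   by convention over an infinite support. *)
Lemma finite_CET n : finite_set (CET n).
Proof.
apply: (@sub_finite_set _ _ [set` trees_upto n]); last exact: finite_seq.
by move=> T [_ <-]; exact: (@mem_trees_upto _ T (leqnSn _)).
Qed.

Definition cw_char (K : fieldType) (X : chernWeil K) (n : nat) : cw_cpx X :=
  \sum_(T \in CET (2 * n)) cw_Phi X (tree_op (ca_m (c := cw_alg X)) T).

(* Main.v *)
Require Import Defs.
From mathcomp Require Import all_boot all_algebra reals.
From mathcomp Require Import all_fingroup complex.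
From mathcomp Require Import boolp classical_sets functions cardinality fsbigop.
From mathcomp Require Import finmap zify.

(** Let [a w] be the sum of the operations [tree_op m T] over the trees [T]
    with [w] vertices, all of even valency.  Such trees have an odd number of
    vertices, so [a w] has even degree, and the character of index [n] is
    [Phi (a (2 * n - 1))].  Collect these elements in the generating series
    [alpha = sum_w a w t^w].  Cutting a tree at its root gives the fixed point
    equation (even_tree_sumS)

      alpha = t * sum_q m_q (alpha, ..., alpha),    q even,

    and the coefficients of a solution are determined one after the other.  So
    a series over [B] that solves the same equation is the generating series
    of [B].

    The solution to use is the push-forward
    [beta = sum_k F_k (alpha, ..., alpha)], where only odd [k] occur.  On
    arguments of even degree all Koszul signs are trivial, and as the even
    [F_k] vanish the identities of a morphism reduce to
    (morphism_identity_even)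

      sum_(r, s) (-1)^r F (x_1, .., x_r, m_s (..), .., x_n)
        = sum_q sum_(i_1 + .. + i_q = n) m_q (F_(i_1), .., F_(i_q)),

    with [s] and [q] even.  Put [alpha] in every slot and sum over [n]: the
    right side becomes [sum_q m_q (beta, ..., beta)].  On the left
    [sum_s m_s (alpha, ..., alpha)] is [alpha / t], so that
    [F_k (alpha, ..., alpha) / t] appears with the factor
    [sum_(r < k) (-1)^r], which is 1 for odd [k].  The total is [beta / t], so
    [beta] solves the equation (pushforwardS), whence the generating series of
    [B] is [beta].

    Finally apply [Psi].  A coefficient of [F_k (alpha, ..., alpha)] is a sum
    over all tuples of indices of given total, a set stable under permutation,
    so for odd [k > 1] the symmetrization axiom kills [k!] times its image, and
    characteristic 0 kills the image (odd_symmetrization_series).  What is left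
    is [Psi (F_1 (a w)) = f (Phi (a w))]. *)

Set Implicit Arguments.
Unset Strict Implicit.
Unset Printing Implicit Defensive.

Import GRing.Theory Num.Theory.
Local Open Scope ring_scope.

(** * Finite sums over triangles and over words *)

Lemma big_triangle (W : nmodType) (H : nat -> nat -> W) N :
  \sum_(0 <= n < N.+1) \sum_(0 <= i < n.+1) H i (n - i)%N =
  \sum_(0 <= i < N.+1) \sum_(0 <= j < (N - i).+1) H i j.
Proof.
elim: N => [|N IH]; first by rewrite !big_nat1.
rewrite big_nat_recr //= IH [RHS]big_nat_recr //= subnn big_nat1.
rewrite [\sum_(0 <= i < N.+2) _]big_nat_recr //= subnn addrA; congr (_ + _).
rewrite -big_split /=; apply: eq_big_nat => i /andP[_ lti].
by rewrite subSn // [RHS]big_nat_recr.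
Qed.

Lemma big_widen_zero (W : nmodType) (H : nat -> W) a b : (a <= b)%N ->
  (forall j, (a <= j)%N -> H j = 0) ->
  \sum_(0 <= j < a) H j = \sum_(0 <= j < b) H j.
Proof.
move=> ab H0; rewrite [RHS](@big_cat_nat _ _ _ a) //= [X in _ = _ + X]big_nat_cond.
by rewrite [X in _ = _ + X]big1 ?addr0 // => j /andP[/andP[aj _] _]; exact: H0.
Qed.

Lemma big_triangle_square (W : nmodType) (H : nat -> nat -> W) N :
  (forall i j, (N < i + j)%N -> H i j = 0) ->
  \sum_(0 <= n < N.+1) \sum_(0 <= i < n.+1) H i (n - i)%N =
  \sum_(0 <= i < N.+1) \sum_(0 <= j < N.+1) H i j.
Proof.
move=> H0; rewrite big_triangle; apply: eq_big_nat => i lti.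
by apply: big_widen_zero => [|j ltj]; [lia | apply: H0; lia].
Qed.

Lemma reshape_nseq (T : Type) (x : T) i n : sumn i = n ->
  reshape i (nseq n x) = map (nseq^~ x) i.
Proof.
elim: i n => //= k i IH n <-.
by rewrite take_nseq ?leq_addr // drop_nseq addKn IH.
Qed.

Lemma size_le_sumn s : all (leq 1) s -> (size s <= sumn s)%N.
Proof. by elim: s => //= k s IH /andP[k_gt0 /IH]; lia. Qed.

Lemma leq_sumn s k : k \in s -> (k <= sumn s)%N.
Proof. by elim: s => //= j s IH; rewrite inE => /predU1P[->|/IH]; lia. Qed.

(** The index set of the sums over compositions and of multinomial expansions,
    as a list, so that these sums can be treated by induction on the length. *)
Fixpoint words (T : Type) (q : nat) (l : seq T) : seq (seq T) :=
  if q is q'.+1 then [seq x :: s | x <- l, s <- words q' l] else [:: [::]].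

Lemma mem_words (T : eqType) q (l s : seq T) :
  (s \in words q l) = (size s == q) && all [in l] s.
Proof.
elim: q s => [|q IH] [|x s] //=.
- by apply/allpairsP => -[[? ?] []].
rewrite eqSS andbCA; apply/allpairsP/andP => [[[y t] /= [yl tw [-> ->]]]|[xl sw]].
  by rewrite -IH.
by exists (x, s); rewrite IH.
Qed.

Lemma uniq_words (T : eqType) q (l : seq T) : uniq l -> uniq (words q l).
Proof.
move=> ul; elim: q => //= q IH; apply: allpairs_uniq => // -[x s] [y t] _ _ /=.
by case=> -> ->.
Qed.

Lemma big_tuple_words (W : nmodType) q M (P : pred (seq nat)) (G : seq nat -> W) :
  \sum_(i : q.-tuple 'I_M | P (map val i)) G (map val i) =
  \sum_(s <- words q (index_iota 0 M) | P s) G s.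
Proof.
rewrite -(big_map (fun i : q.-tuple 'I_M => map val i) P G) /=.
apply: perm_big; apply: uniq_perm.
- rewrite map_inj_uniq ?index_enum_uniq // => s t /inj_map eq_st.
  by apply/val_inj/eq_st/val_inj.
- by apply: uniq_words; rewrite iota_uniq.
move=> s; rewrite mem_words; apply/mapP/andP => [[t _ ->]|[/eqP szs /allP sM]].
  rewrite size_map size_tuple eqxx; split=> //.
  by apply/allP => _ /mapP[j _ ->]; rewrite /= mem_index_iota /=.
have sE : map val (pmap (insub : nat -> option 'I_M) s) = s.
  rewrite (pmap_filter (insubK _)); apply/all_filterP/allP => j /sM.
  by rewrite /= mem_index_iota /= isSome_insub.
have szt : size (pmap (insub : nat -> option 'I_M) s) == q.
  by rewrite -szs -[in X in _ == X]sE size_map.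
by exists (Tuple szt); rewrite ?mem_index_enum //= sE.
Qed.

(** The letters of a word of sum [n] are at most [n], so the alphabet may be
    cut anywhere above [n].  This lets compositions of different [n] share one
    alphabet. *)
Lemma big_words_widen (W : nmodType) q n a b (G : seq nat -> W) :
  (n <= a)%N -> (n <= b)%N ->
  \sum_(s <- words q (index_iota 0 a.+1) | sumn s == n) G s =
  \sum_(s <- words q (index_iota 0 b.+1) | sumn s == n) G s.
Proof.
move=> le_na le_nb; rewrite -[LHS]big_filter -[RHS]big_filter.
apply/perm_big/uniq_perm; rewrite ?filter_uniq ?uniq_words ?iota_uniq // => s.
rewrite !mem_filter !mem_words; case: eqP => //= sn; congr (_ && _).
have bnd c : (n <= c)%N -> all [in index_iota 0 c.+1] s.
  move=> le_nc; apply/allP => k /leq_sumn le_k; rewrite /= mem_index_iota; lia.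
by rewrite !bnd.
Qed.

(** * Multilinear maps *)

Section Multilinear.
Context {K : fieldType} {V W : lmodType K}.
Implicit Types (g : seq V -> W) (s t : seq V).

Lemma multilinear_cons g x : multilinear g -> multilinear (fun s => g (x :: s)).
Proof. by move=> gL s t a y z; rewrite -!cat_cons gL. Qed.

Lemma multilinear0 g s t : multilinear g -> g (s ++ 0 :: t) = 0.
Proof.
move=> gL; have := gL s t 1 0 0; rewrite !scale1r addr0 => /eqP.
by rewrite -subr_eq0 opprD addNKr oppr_eq0 => /eqP.
Qed.

Lemma multilinear_sum g s t I (r : seq I) (P : pred I) (x : I -> V) :
  multilinear g ->
  g (s ++ (\sum_(i <- r | P i) x i) :: t) = \sum_(i <- r | P i) g (s ++ x i :: t).
Proof.
move=> gL; apply: (big_morph (fun y => g (s ++ y :: t))) => [y z|].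
  by have := gL s t 1 y z; rewrite !scale1r.
exact: multilinear0.
Qed.

End Multilinear.

Section EvenPart.
Context {K : fieldType} {V W : lmodType K}.

(** Working with the even operations only, as one multilinear family, absorbs
    both the valency condition on the trees and the parity bookkeeping in the
    identities of a morphism. *)
Definition even_part (m : seq V -> W) (xs : seq V) : W :=
  if odd (size xs) then 0 else m xs.

Lemma even_part_multilinear m : multilinear m -> multilinear (even_part m).
Proof.
move=> mL s t a x y; rewrite /even_part !size_cat /=.
by case: ifP => _; [rewrite scaler0 addr0 | exact: mL].
Qed.

Lemma multilinear_mem0 (m : seq V -> W) xs : multilinear m -> 0 \in xs ->
  m xs = 0.
Proof. by move=> mL /splitPr[s t]; exact: multilinear0. Qed.

End EvenPart.

(** * Multilinear maps on power series *)

(** Series are identified with their coefficient functions: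
    [series_ext g us N] is the coefficient of [t ^ N] in the value at [us] of
    the extension of [g] that is multilinear over power series in [t].  The
    recursion expands the first slot. *)
Fixpoint series_ext (V : Type) (W : nmodType) (g : seq V -> W)
    (us : seq (nat -> V)) (N : nat) : W :=
  if us is u :: us' then
    \sum_(0 <= i < N.+1) series_ext (fun xs => g (u i :: xs)) us' (N - i)
  else if N == 0%N then g [::] else 0.

Section SeriesExtBasic.
Context {V : Type} {W : nmodType}.
Implicit Types (g h : seq V -> W) (u v : nat -> V) (us vs : seq (nat -> V)).

(** Used with [P := even_deg], to apply an identity that holds only on
    arguments of even degree. *)
Lemma eq_series_ext_in (P : V -> Prop) g h us N :
  foldr and True [seq (forall j, P (u j)) | u <- us] ->
  (forall xs, size xs = size us -> foldr and True [seq P x | x <- xs] ->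
    g xs = h xs) ->
  series_ext g us N = series_ext h us N.
Proof.
elim: us g h N => [|u us IH] g h N /=; first by move=> _ ->.
move=> [Pu Pus] gh; apply: eq_bigr => i _; apply: IH => // xs sz Pxs.
by apply: gh => //=; rewrite sz.
Qed.

Lemma eq_series_ext g h us N :
  (forall xs, size xs = size us -> g xs = h xs) ->
  series_ext g us N = series_ext h us N.
Proof.
move=> gh; apply: (@eq_series_ext_in (fun=> True)) => [|xs sz _]; last exact: gh.
by elim: us {gh}.
Qed.

Lemma series_ext_congr_nseq g u v q N :
  (forall j, (j <= N)%N -> u j = v j) ->
  series_ext g (nseq q u) N = series_ext g (nseq q v) N.
Proof.
elim: q g N => //= q IH g N uv; apply: eq_big_nat => i /andP[_ lti].
by rewrite uv //; apply: IH => j ltj; apply: uv; lia.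
Qed.

Lemma series_ext0 us N : series_ext (fun=> 0 : W) us N = 0.
Proof.
elim: us N => [|u us IH] N /=; first by case: ifP.
by rewrite big1.
Qed.

Lemma series_ext_sum I (r : seq I) (P : pred I) (g : I -> seq V -> W) us N :
  series_ext (fun xs => \sum_(i <- r | P i) g i xs) us N =
  \sum_(i <- r | P i) series_ext (g i) us N.
Proof.
elim: us g N => [|u us IH] g N /=; first by case: ifP => // _; rewrite big1.
by rewrite exchange_big /=; apply: eq_bigr => j _; rewrite IH.
Qed.

(** Scalar extension is compatible with composition in the first slot.  Both
    sides expand into the same sum over [j] (degree of the first series) and
    [i] (degree of the other series fed to [h]), summed over a triangle in the
    two possible orders. *)
Lemma series_ext_splice (V' : nmodType) (G : V' -> seq V -> W) (h : seq V -> V')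
    s us N :
  (forall y z xs, G (y + z) xs = G y xs + G z xs) ->
  (forall xs, G 0 xs = 0) -> (s <= size us)%N ->
  series_ext (fun xs => G (h (take s xs)) (drop s xs)) us N =
  \sum_(0 <= i < N.+1)
    series_ext (G (series_ext h (take s us) i)) (drop s us) (N - i).
Proof.
move=> GD G0; elim: s us h N => [|s IH] us h N.
  move=> _; rewrite take0 drop0 big_nat_recl //= subn0 big1 ?addr0; last first.
    by move=> i _; under eq_series_ext do rewrite G0; rewrite series_ext0.
  by apply: eq_series_ext => xs _; rewrite take0 drop0.
case: us => // u us /=; rewrite ltnS => le_s.
under eq_bigr => j _ do rewrite (IH _ (fun xs => h (u j :: xs))) //.
under [RHS]eq_bigr => i _.
  rewrite (@eq_series_ext _ (fun xs => \sum_(0 <= j < i.+1)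
    G (series_ext (fun xs => h (u j :: xs)) (take s us) (i - j)) xs)).
    rewrite series_ext_sum; over.
  by move=> xs _; apply: (big_morph (G^~ xs)) => [y z|].
pose H j i := series_ext
  (G (series_ext (fun xs => h (u j :: xs)) (take s us) i)) (drop s us)
  (N - (j + i)).
transitivity (\sum_(0 <= j < N.+1) \sum_(0 <= i < (N - j).+1) H j i).
  by apply: eq_bigr => j _; apply: eq_bigr => i _; rewrite /H subnDA.
rewrite -big_triangle; apply: eq_bigr => n _; apply: eq_big_nat => j /andP[_ lej].
by rewrite /H subnKC.
Qed.

End SeriesExtBasic.

Section SeriesExtLinear.
Context {K : fieldType} {V W : lmodType K}.
Implicit Types (g : seq V -> W) (u : nat -> V) (us vs : seq (nat -> V)).

Lemma series_ext_scale a g us N :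
  series_ext (fun xs => a *: g xs) us N = a *: series_ext g us N.
Proof.
elim: us g N => [|u us IH] g N /=; first by case: ifP => // _; rewrite scaler0.
by rewrite scaler_sumr; apply: eq_bigr => j _; rewrite IH.
Qed.

(** A coefficient of order [N] sees the series only up to order [N]; this is
    what allows the infinite sums of the theory to be truncated. *)
Lemma series_ext_slot_sum g us vs u N I (r : seq I) (P : pred I)
    (v : I -> nat -> V) :
  multilinear g ->
  (forall j, (j <= N)%N -> u j = \sum_(i <- r | P i) v i j) ->
  series_ext g (us ++ u :: vs) N =
  \sum_(i <- r | P i) series_ext g (us ++ v i :: vs) N.
Proof.
elim: us g N => [|w us IH] g N gL uv /=.
  rewrite exchange_big /=; apply: eq_big_nat => j /andP[_ lej].
  rewrite -series_ext_sum; apply: eq_series_ext => xs _.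
  by rewrite uv // (multilinear_sum [::]).
rewrite exchange_big /=; apply: eq_big_nat => j /andP[_ lej].
by apply: IH => [|i lei]; [exact: multilinear_cons | apply: uv; lia].
Qed.

Lemma series_ext_slot0 g us vs u N : multilinear g -> (forall j, u j = 0) ->
  series_ext g (us ++ u :: vs) N = 0.
Proof.
move=> gL u0.
rewrite (@series_ext_slot_sum g us vs u N _ [::] xpredT (fun i : nat => u)) //.
  by rewrite big_nil.
by move=> j _; rewrite big_nil.
Qed.

(** Orders of vanishing add up under multiplication, so only finitely many
    arities contribute to a given coefficient. *)
Lemma series_ext_order (T : Type) (phi : T -> nat -> V) (o : T -> nat) g js N :
  multilinear g -> (forall t j, (j < o t)%N -> phi t j = 0) ->
  (N < sumn (map o js))%N -> series_ext g (map phi js) N = 0.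
Proof.
move=> gL phi0; elim: js g N gL => [|t js IH] g N gL //= ltN.
rewrite big_nat_cond big1 // => i /andP[/andP[_ lei] _].
have [lt_io|le_oi] := ltnP i (o t).
  rewrite -[RHS](series_ext0 (map phi js) (N - i)); apply: eq_series_ext => xs _.
  by rewrite phi0 // (multilinear0 [::]).
by apply: IH; [exact: multilinear_cons | lia].
Qed.

(** This is how [alpha / t] in one slot becomes [alpha] there and a shift of the
    whole coefficient. *)
Lemma series_ext_shift g us vs u N : multilinear g -> u 0%N = 0 ->
  series_ext g (us ++ u :: vs) N.+1 =
  series_ext g (us ++ (fun j => u j.+1) :: vs) N.
Proof.
move=> gL u0; elim: us g gL N => [|w us IH] g gL N /=.
  rewrite big_nat_recl //= (eq_series_ext (h := fun=> 0)) ?series_ext0 ?add0r //.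
  by move=> xs _; rewrite u0 (multilinear0 [::]).
rewrite big_nat_recr //= subnn (@series_ext_slot_sum _ _ _ _ _ nat [::] xpredT
    (fun=> u)) ?big_nil ?addr0; first last.
- by move=> j; rewrite leqn0 big_nil => /eqP->.
- exact: multilinear_cons.
apply: eq_big_nat => i /andP[_ lei]; rewrite subSn // IH //.
exact: multilinear_cons.
Qed.

Lemma series_ext_insert (m : seq V -> V) g r s us N :
  multilinear g -> (r + s <= size us)%N ->
  series_ext (insert_op m r s \; g) us N =
  series_ext g (take r us ++ series_ext m (take s (drop r us)) :: drop (r + s) us) N.
Proof.
rewrite /insert_op; elim: r us g N => [|r IH] us g N gL.
  rewrite add0n drop0 take0 => le_s.
  rewrite /= -(@series_ext_splice _ _ _ (fun y xs => g (y :: xs))) //.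
  - by apply: eq_series_ext => xs _ /=; rewrite take0 drop0.
  - by move=> y z xs; have := gL [::] xs 1 y z; rewrite !scale1r.
  - by move=> xs; rewrite (multilinear0 [::]).
case: us => // u us le_rs /=; apply: eq_bigr => i _.
by rewrite -IH //; exact: multilinear_cons.
Qed.

End SeriesExtLinear.

Lemma series_ext_reshape (K : fieldType) (U V W : lmodType K)
    (F : seq U -> V) (m : seq V -> W) (i : seq nat) us N :
  multilinear m -> sumn i = size us ->
  series_ext (fun xs => m (map F (reshape i xs))) us N =
  series_ext m (map (series_ext F) (reshape i us)) N.
Proof.
elim: i us m N => [|k i IH] us m N mL /=; first by move/esym/size0nil->.
move=> szi; rewrite (@series_ext_splice _ _ _
  (fun y xs => m (y :: map F (reshape i xs)))).
- apply: eq_bigr => j _ /=.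
  rewrite (IH _ (fun ys => m (series_ext F (take k us) j :: ys))) //.
    exact: multilinear_cons.
  by rewrite size_drop -szi addKn.
- by move=> y z xs; have := mL [::] (map F (reshape i xs)) 1 y z; rewrite !scale1r.
- by move=> xs; rewrite (multilinear0 [::]).
by rewrite -szi leq_addr.
Qed.

(** Multinomial expansion of [g (.., u, .., u)] for [u] a sum of series. *)
Lemma series_ext_words (K : fieldType) (V W : lmodType K) (g : seq V -> W)
    (T : Type) (l : seq T) (v : T -> nat -> V) (u : nat -> V) us q N :
  multilinear g -> (forall j, (j <= N)%N -> u j = \sum_(x <- l) v x j) ->
  series_ext g (us ++ nseq q u) N =
  \sum_(s <- words q l) series_ext g (us ++ map v s) N.
Proof.
move=> gL uv; elim: q us => [|q IH] us /=; first by rewrite big_seq1.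
rewrite big_allpairs_dep /= (series_ext_slot_sum _ _ gL uv); apply: eq_bigr => x _.
by rewrite -cat_rcons IH; apply: eq_bigr => s _; rewrite cat_rcons.
Qed.

Lemma series_ext1 (V : Type) (W : nmodType) (g : seq V -> W) u N :
  series_ext g [:: u] N = g [:: u N].
Proof.
rewrite /= big_nat_recr //= subnn eqxx big1_seq ?add0r // => i /andP[_].
by rewrite mem_index_iota => lti; rewrite ifF //; lia.
Qed.

Lemma series_ext_nseq (V : Type) (W : nmodType) (g : seq V -> W) (u : nat -> V)
    k w M : (w <= M)%N ->
  series_ext g (nseq k u) w =
  \sum_(s <- words k (index_iota 0 M.+1) | sumn s == w) g (map u s).
Proof.
elim: k g w => [|k IH] g w le_wM.
  by rewrite big_mkcond big_seq1 /= eq_sym.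
rewrite [RHS]big_mkcond big_allpairs_dep /=.
rewrite [RHS](@big_cat_nat _ _ _ w.+1) //= [X in _ = _ + X]big_nat_cond.
rewrite [X in _ = _ + X]big1 ?addr0 => [|i /andP[/andP[lei _] _]]; last first.
  by rewrite big1 // => s _; case: eqP => //; lia.
apply: eq_big_nat => i /andP[_ lei]; rewrite IH ?big_mkcond /=; last by lia.
apply: eq_bigr => s _; congr (if _ then _ else _).
by apply/eqP/eqP; lia.
Qed.

(** * Sums over even trees *)

(** The generated induction principle gives no hypothesis on the subtrees,
    which are nested in a list. *)
Lemma planarTree_ind_forest (P : planarTree -> Prop) :
  (forall Ts, {in Ts, forall T, P T} -> P (Node Ts)) -> forall T, P T.
Proof.
move=> PNode; fix IH 1; case=> Ts; apply: PNode.
elim: Ts => [|T Ts IHTs] U; first by rewrite in_nil => /notF[].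
by rewrite inE => /predU1P[->|/IHTs]; [apply: IH | apply].
Qed.

Lemma uniq_seqs_upto (T : eqType) k (l : seq T) : uniq l -> uniq (seqs_upto k l).
Proof.
move=> ul; elim: k => //= k IH; apply/andP; split.
  by apply/allpairsP => -[[? ?] []].
by apply: allpairs_uniq => // -[x s] [y t] _ _ /= [-> ->].
Qed.

Lemma uniq_trees_upto n : uniq (trees_upto n).
Proof.
elim: n => //= n IH; rewrite map_inj_uniq ?uniq_seqs_upto //.
by move=> Ts Us [].
Qed.

(** The root counts for one and each of the evenly many subtrees for an odd
    number. *)
Lemma odd_even_valencies T : even_valencies T -> odd (tree_vertices T).
Proof.
elim/planarTree_ind_forest: T => Ts IH /= /andP[ev_size /allP evTs].
suff -> : odd (sumn (map tree_vertices Ts)) = odd (size Ts) by [].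
elim: Ts {ev_size} IH evTs => //= T Ts IHTs IH evTs; rewrite oddD IHTs.
- by rewrite IH ?evTs ?mem_head.
- by move=> U UTs; apply: IH; rewrite inE UTs orbT.
by move=> U UTs; apply: evTs; rewrite inE UTs orbT.
Qed.

(** Summing over forests is multiplying generating series: a forest of [q]
    trees with [w] vertices in all contributes to the coefficient of [t ^ w] in
    [g (u, .., u)] with [q] slots. *)
Lemma big_seqs_upto (K : fieldType) (V W : lmodType K) (g : seq V -> W)
    (T : Type) (l : seq T) (P : pred T) (v : T -> nat) (h : T -> V)
    (u : nat -> V) k w :
  multilinear g ->
  (forall j, (j <= w)%N -> u j = \sum_(x <- l | P x && (v x == j)) h x) ->
  \sum_(s <- seqs_upto k l | all P s && (sumn (map v s) == w)) g (map h s) =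
  \sum_(0 <= q < k.+1) series_ext g (nseq q u) w.
Proof.
elim: k g w => [|k IH] g w gL uE.
  by rewrite big_nat1 big_mkcond big_seq1 /= eq_sym.
rewrite [LHS]big_mkcond /= big_cons big_nat_recl //= [w == _]eq_sym; congr (_ + _).
rewrite big_allpairs_dep /= exchange_big [RHS]exchange_big /=.
transitivity (\sum_(0 <= i < w.+1) \sum_(s <- seqs_upto k l) \sum_(x <- l)
   (if P x && (v x == i) then
      if all P s && (sumn (map v s) == w - i)%N then g (h x :: map h s) else 0
    else 0)).
  rewrite [RHS]exchange_big /=; apply: eq_bigr => s _.
  rewrite [RHS]exchange_big /=; apply: eq_bigr => x _.
  case: (P x) => /=; last by rewrite big1.
  rewrite -big_mkcond; under eq_bigl do rewrite eq_sym.
  rewrite big_nat1_eq /= ltnS; case: leqP => [le_v|lt_v].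
    by congr (if _ && _ then _ else _); apply/eqP/eqP; lia.
  by rewrite ifF //; apply/negbTE/negP => /andP[_ /eqP]; lia.
apply: eq_big_nat => i /andP[_ lei].
rewrite -(IH (fun xs => g (u i :: xs))); first last.
- by move=> j lej; apply: uE; lia.
- exact: multilinear_cons.
rewrite [RHS]big_mkcond; apply: eq_bigr => s _.
rewrite -big_mkcond; case: ifP => _; last by rewrite big1.
by rewrite uE // (multilinear_sum [::]).
Qed.

Lemma gv_deg_sum (K : fieldType) (V : gradedVect K) d I (r : seq I)
    (P : pred I) (x : I -> V) :
  (forall i, P i -> gv_deg d (x i)) -> gv_deg d (\sum_(i <- r | P i) x i).
Proof.
move=> xd; elim/big_rec: _ => [|i y Pi yd]; first exact: gv_deg0.
by rewrite -[x i]scale1r; apply: gv_degP => //; exact: xd.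
Qed.

Section TreeSums.
Context {K : fieldType} (A : curvedAinf K).
Local Notation m := (ca_m (c := A)).

Definition even_tree_sum (w : nat) : A :=
  \sum_(T <- trees_upto w | even_valencies T && (tree_vertices T == w))
    tree_op m T.

(** The bound in [trees_upto] is immaterial once it reaches [w]. *)
Lemma even_tree_sumE w (l : seq planarTree) :
  uniq l -> (forall T, tree_vertices T = w -> T \in l) ->
  even_tree_sum w =
  \sum_(T <- l | even_valencies T && (tree_vertices T == w)) tree_op m T.
Proof.
move=> ul lw; rewrite /even_tree_sum -[LHS]big_filter -[RHS]big_filter.
apply/perm_big/uniq_perm; rewrite ?filter_uniq ?uniq_trees_upto //.
move=> T; rewrite !mem_filter; case: eqP => [eqw|]; last by rewrite andbF.
by rewrite lw // mem_trees_upto // eqw.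
Qed.

Lemma even_tree_sum0 : even_tree_sum 0 = 0.
Proof. by rewrite /even_tree_sum big_nil. Qed.

(** The fixed point equation: a tree is a root carrying a forest, and the root
    accounts for the shift of the index by one. *)
Lemma even_tree_sumS M w : (w <= M)%N ->
  even_tree_sum w.+1 =
  \sum_(0 <= q < M.+1) series_ext (even_part m) (nseq q even_tree_sum) w.
Proof.
move=> le_wM; rewrite (@even_tree_sumE _ (trees_upto M.+1)) ?uniq_trees_upto //.
  rewrite big_map -(@big_seqs_upto _ _ _ _ _ (trees_upto M) even_valencies
    tree_vertices (tree_op m)).
  - rewrite /= big_mkcond [RHS]big_mkcond; apply: eq_bigr => Ts _.
    rewrite /even_part size_map eqSS; case: (odd _) => //=.
    by rewrite if_same.
  - exact/even_part_multilinear/ca_linear.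
  - move=> j lej; apply: even_tree_sumE; rewrite ?uniq_trees_upto // => T Tj.
    by apply: mem_trees_upto; lia.
by move=> T Tw; apply: mem_trees_upto; lia.
Qed.

(** A vertex with [s] subtrees changes the degree by [2 - s]; each subtree has
    degree one more than its number of vertices, so the [s] cancels. *)
Lemma gv_deg_tree_op T : gv_deg (tree_degree T) (tree_op m T).
Proof.
elim/planarTree_ind_forest: T => Ts IH.
have hTs : homogeneous (map tree_degree Ts) (map (tree_op m) Ts).
  elim: Ts IH => //= T Ts IHTs IH; split; first exact/IH/mem_head.
  by apply: IHTs => U UTs; apply: IH; rewrite inE UTs orbT.
have := ca_degree hTs; rewrite size_map.
suff -> : sumn (map tree_degree Ts) = (sumn (map tree_vertices Ts) + size Ts)%N.
  by rewrite PoszD addrACA subrr addr0 -PoszD addn2.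
by elim: Ts {IH hTs} => //= T Ts ->; rewrite /tree_degree; lia.
Qed.

Lemma even_deg_tree_sum w : even_deg (even_tree_sum w).
Proof.
exists (uphalf w); apply: gv_deg_sum => T /andP[/odd_even_valencies oddT /eqP wE].
have -> : (2 * uphalf w = tree_degree T)%N.
  by rewrite /tree_degree; move: oddT; rewrite wE; lia.
exact: gv_deg_tree_op.
Qed.

End TreeSums.

Lemma cw_charE (K : fieldType) (X : chernWeil K) n : (0 < n)%N ->
  cw_char X n = cw_Phi X (even_tree_sum (cw_alg X) (2 * n).-1).
Proof.
move=> n_gt0; rewrite /cw_char fsbig_finite; last exact: finite_CET.
rewrite /even_tree_sum linear_sum /= -[RHS]big_filter.
apply/perm_big/uniq_perm; rewrite ?filter_uniq ?uniq_trees_upto ?fset_uniq //.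
move=> T; rewrite in_fset_set ?mem_filter; last exact: finite_CET.
apply/idP/idP => [/set_mem [-> Tn]|/andP[/andP[eT /eqP Tn] _]] /=.
  by move: Tn; rewrite /tree_degree => Tn; rewrite mem_trees_upto; lia.
by apply/mem_set; split=> //; rewrite /tree_degree; lia.
Qed.

(** * The morphism identity on arguments of even degree *)

Lemma even_deg_homogeneous (K : fieldType) (V : gradedVect K) (xs : seq V) :
  foldr and True [seq even_deg x | x <- xs] ->
  exists2 ds, homogeneous ds xs & all (fun d => ~~ odd d) ds.
Proof.
elim: xs => [_|x xs IH /= [[i xi] /IH[ds dsxs evds]]]; first by exists [::].
by exists (2 * i :: ds)%N => //=; rewrite evds oddM.
Qed.

Lemma odd_sumn s : all odd s -> odd (sumn s) = odd (size s).
Proof. by elim: s => //= d s IH /andP[od /IH<-]; rewrite oddD od. Qed.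

Lemma even_composition_weight i : all odd i -> ~~ odd (composition_weight i).
Proof.
move=> /(all_nthP 0%N) oi; rewrite /composition_weight.
rewrite big_nat_cond; elim/big_rec: _ => // l x /andP[/andP[l1 l2] _].
rewrite oddD => /negPf->; rewrite addbF oddM negb_and.
by have := oi l.-1; lia.
Qed.

Lemma even_composition_koszul i ds : all odd i -> ~~ odd (composition_koszul i ds).
Proof.
move=> /(all_nthP 0%N) oi; rewrite /composition_koszul.
rewrite big_nat_cond; elim/big_rec: _ => // l x /andP[/andP[l1 l2] _].
rewrite oddD => /negPf->; rewrite addbF oddM negb_and.
by have := oi l.-1; lia.
Qed.

(** For an odd number of arguments both sides vanish: on the left an even [s]
    leaves an even number of arguments for [F], and on the right an even number
    of odd summands cannot have an odd sum.  For an even number of arguments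
    every nonzero term has all its indices [s], [i_l] of the parity that makes
    the signs trivial, except for [(-1)^r].  The empty list of arguments is the
    compatibility with curvatures. *)
Lemma morphism_identity_even (K : fieldType) (A B : curvedAinf K)
    (F : ainfMorphism A B) (xs : seq A) :
  (forall ys : seq A, ~~ odd (size ys) -> F ys = 0) ->
  foldr and True [seq even_deg x | x <- xs] ->
  \sum_(0 <= r < (size xs).+1) \sum_(0 <= s < (size xs - r).+1)
    (-1) ^+ r *: F (insert_op (even_part (ca_m (c := A))) r s xs) =
  \sum_(0 <= q < (size xs).+1)
    \sum_(i : q.-tuple 'I_(size xs).+1 | sumn (map val i) == size xs)
      even_part (ca_m (c := B)) (map F (reshape (map val i) xs)).
Proof.
move=> F_even evxs; set n := size xs.
have FL := am_linear F; have mL := @ca_linear _ B.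
have szins (h : seq A -> A) r s : (r + s <= n)%N ->
    size (insert_op h r s xs) = (n - s).+1.
  move=> le_n; rewrite /insert_op size_cat /= size_take_min size_drop.
  by rewrite -/n; lia.
(* An even block of arguments is sent to 0 by [F]. *)
have me0 i : sumn i = n -> ~~ all odd i -> 0 \in map F (reshape i xs).
  move=> sumi /allPn[k + evk]; rewrite -{1}(reshapeKl (eq_leq sumi)).
  case/mapP=> ys ysi szk; rewrite szk in evk.
  by apply/mapP; exists ys; rewrite ?F_even.
have szres i : sumn i = n -> size (map F (reshape i xs)) = size i.
  by move=> sumi; rewrite size_map size_reshape.
have [odd_n|ev_n] := boolP (odd n).
  rewrite big1_seq => [|r /andP[_]]; last first.
    rewrite mem_index_iota => /andP[_ ltr]; rewrite big1_seq // => s /andP[_].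
    rewrite mem_index_iota => /andP[_ lts]; have le_n : (r + s <= n)%N by lia.
    have [odd_s|ev_s] := boolP (odd s); last first.
      by rewrite F_even ?scaler0 // szins //=; lia.
    rewrite /insert_op /even_part size_take_min size_drop.
    have -> : minn s (size xs - r) = s by rewrite -/n; lia.
    by rewrite odd_s multilinear0 ?scaler0.
  rewrite big1 // => q _; rewrite big1 // => i /eqP sumi.
  have [oi|] := boolP (all odd (map val i)); last first.
    by move=> /(me0 _ sumi)/multilinear_mem0->; last exact: even_part_multilinear.
  by rewrite /even_part szres // -odd_sumn // sumi odd_n.
have [n0|n_gt0] := posnP n.
  rewrite /n (size0nil n0) /= !big_nat1 expr0 scale1r /insert_op /even_part /=.
  rewrite am_curvature.
  rewrite (big_pred1 [tuple]) //= => t.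
  by rewrite (tuple0 t); exact/esym/eqxx.
have [ds hds evds] := even_deg_homogeneous evxs.
have := am_stasheff F n_gt0 hds.
rewrite /stasheff_sum /composition_sum -/n => eqF.
transitivity (\sum_(0 <= r < n.+1) \sum_(0 <= s < (n - r).+1)
    (((-1) ^+ (r + s * (n - r - s)) * (-1) ^+ (s * sumn (take r ds)))
      *: F (insert_op (ca_m (c := A)) r s xs) : B)).
  apply: eq_big_nat => r /andP[_ ltr]; apply: eq_big_nat => s /andP[_ lts].
  have le_n : (r + s <= n)%N by lia.
  have [odd_s|ev_s] := boolP (odd s).
    by rewrite !F_even ?scaler0 // szins //=; lia.
  rewrite -[(-1) ^+ (s * _)]signr_odd oddM (negPf ev_s) /= expr0 mulr1.
  rewrite -signr_odd -[in RHS]signr_odd oddD oddM (negPf ev_s) /= addbF.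
  congr (_ *: F _); rewrite /insert_op /even_part size_take_min size_drop.
  have -> : minn s (size xs - r) = s by rewrite -/n; lia.
  by rewrite (negPf ev_s).
rewrite {}eqF [RHS]big_nat_recl //= [X in _ = X + _]big1 ?add0r => [|i]; last first.
  by rewrite tuple0 /= eq_sym => /eqP n0; rewrite n0 in n_gt0.
rewrite big_add1 /=; apply: eq_bigr => q _.
rewrite big_mkcond [RHS]big_mkcond /=; apply: eq_bigr => i _.
have [sumi|] := eqVneq; last by rewrite andbF.
rewrite andbT; have [oi|noi] := boolP (all odd (map val i)); last first.
  have i0 := me0 _ sumi noi.
  rewrite !(multilinear_mem0 _ i0) ?scaler0 ?if_same //.
  exact: even_part_multilinear.
rewrite ifT; last by apply: sub_all oi => -[].
rewrite -[(-1) ^+ _]signr_odd (negPf (even_composition_weight oi)).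
rewrite -[(-1) ^+ composition_koszul _ _]signr_odd.
rewrite (negPf (even_composition_koszul ds oi)).
rewrite !expr0 mulr1 scale1r /even_part szres // ifF //.
by rewrite -odd_sumn // sumi; apply/negbTE.
Qed.

(** * Push-forward of a series along a morphism *)

Section Pushforward.
Context {K : fieldType} (A B : curvedAinf K) (F : ainfMorphism A B).
Context (u : nat -> A).
Context (F_even : forall xs : seq A, ~~ odd (size xs) -> F xs = 0).
Context (u_even : forall w, even_deg (u w)).
Local Notation mA := (even_part (ca_m (c := A))).
Local Notation mB := (even_part (ca_m (c := B))).

Definition pushforward_term k : nat -> B := series_ext F (nseq k u).

Definition pushforward w : B := \sum_(0 <= k < w.+1) pushforward_term k w.

(** The morphism identity persists after extension of scalars to power series,
    since [series_ext] commutes with inserting an operation and with cutting the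
    arguments into blocks. *)
Lemma morphism_identity_series n N :
  \sum_(0 <= r < n.+1) \sum_(0 <= s < (n - r).+1)
    (-1) ^+ r *: series_ext F
      (nseq r u ++ series_ext mA (nseq s u) :: nseq (n - r - s) u) N =
  \sum_(0 <= q < n.+1) \sum_(s <- words q (index_iota 0 n.+1) | sumn s == n)
    series_ext mB (map pushforward_term s) N.
Proof.
have FL := am_linear F.
transitivity (series_ext (fun xs => \sum_(0 <= r < n.+1)
    \sum_(0 <= s < (n - r).+1) (-1) ^+ r *: F (insert_op mA r s xs))
    (nseq n u) N).
  rewrite series_ext_sum; apply: eq_big_nat => r /andP[_ ltr].
  rewrite series_ext_sum; apply: eq_big_nat => s /andP[_ lts].
  rewrite series_ext_scale; congr (_ *: _).
  have := @series_ext_insert _ _ _ mA F r s (nseq n u) N FL.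
  rewrite size_nseq => -> //; last by lia.
  rewrite take_nseq; last by lia.
  by rewrite !drop_nseq take_nseq ?subnDA //; lia.
transitivity (series_ext (fun xs => \sum_(0 <= q < n.+1)
    \sum_(i : q.-tuple 'I_n.+1 | sumn (map val i) == n)
      mB (map F (reshape (map val i) xs))) (nseq n u) N).
  apply: (@eq_series_ext_in _ _ (@even_deg K A)) => [|xs].
    by elim: (n) => //= k IH; split.
  by rewrite size_nseq => <- evxs; exact: morphism_identity_even.
rewrite series_ext_sum; apply: eq_bigr => q _.
rewrite series_ext_sum -(@big_tuple_words _ _ _ (fun s => sumn s == n)
  (fun s => series_ext mB (map pushforward_term s) N)).
apply: eq_bigr => i /eqP sumi; rewrite series_ext_reshape ?size_nseq //.
  by rewrite reshape_nseq // -map_comp.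
exact/even_part_multilinear/ca_linear.
Qed.

Lemma pushforward_term_even k w : ~~ odd k -> pushforward_term k w = 0.
Proof.
move=> evk; rewrite -[RHS](series_ext0 (nseq k u) w); apply: eq_series_ext => xs.
by rewrite size_nseq => szk; rewrite F_even // szk.
Qed.

Context (u0 : u 0%N = 0).
Context (uS : forall M w, (w <= M)%N ->
  u w.+1 = \sum_(0 <= q < M.+1) series_ext mA (nseq q u) w).

Lemma series_ext_nseq_order (W : lmodType K) (g : seq A -> W) k w :
  multilinear g -> (w < k)%N -> series_ext g (nseq k u) w = 0.
Proof.
move=> gL ltwk; rewrite -(map_nseq k (fun=> u) tt).
apply: (@series_ext_order _ _ _ _ _ (fun=> 1%N)) => //; first by move=> _ [].
by rewrite map_nseq sumn_nseq mul1n.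
Qed.

(** The series [u] has no constant term, so its [k]-fold terms start in
    order [k]. *)
Lemma pushforwardE M w : (w <= M)%N ->
  pushforward w = \sum_(0 <= k < M.+1) pushforward_term k w.
Proof.
move=> le_wM; apply: big_widen_zero => // k ltk.
exact: series_ext_nseq_order (am_linear F) ltk.
Qed.

(** Among the terms with [r + t + 1 = k] the signs add up to 1 if [k] is odd,
    and the terms with [k] even are zero. *)
Lemma sum_alternating_pushforward N :
  \sum_(0 <= r < N.+1) \sum_(0 <= t < N.+1)
    (-1) ^+ r *: pushforward_term (r + t).+1 N.+1 = pushforward N.+1.
Proof.
rewrite -big_triangle_square => [|r t ltN]; last first.
  by rewrite /pushforward_term series_ext_nseq_order ?scaler0 //; exact: am_linear.
rewrite /pushforward [RHS]big_nat_recl // pushforward_term_even // add0r.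
apply: eq_big_nat => k _.
rewrite (@eq_big_nat _ _ _ _ _ _ (fun r => (-1) ^+ r *: pushforward_term k.+1 N.+1)).
  rewrite -scaler_suml; have [oddk|evk] := boolP (odd k).
    by rewrite pushforward_term_even ?scaler0 //= oddk.
  have -> : k.+1 = (k./2.*2).+1 by lia.
  rewrite big_nat_recr //=; set z := (X in X + _); suff -> : z = 0.
    by rewrite add0r -signr_odd odd_double scale1r.
  rewrite {}/z; elim: k./2 => [|j IH]; first by rewrite big_nil.
  by rewrite doubleS !big_nat_recr //= IH add0r exprS mulN1r subrr.
by move=> r /andP[_ ltr]; rewrite subnKC.
Qed.

(** The push-forward inherits the fixed point equation: the sum over the number
    [n] of slots of the morphism identity at [(u, .., u)], in order [N]. *)
Lemma pushforwardS N :
  pushforward N.+1 = \sum_(0 <= q < N.+1) series_ext mB (nseq q pushforward) N.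
Proof.
have FL := am_linear F.
have mAL : multilinear mA by exact/even_part_multilinear/ca_linear.
have mBL : multilinear mB by exact/even_part_multilinear/ca_linear.
(* The term with [r] slots before and [t] slots after the inserted operation. *)
pose H r s t := (-1) ^+ r *: series_ext F
  (nseq r u ++ series_ext mA (nseq s u) :: nseq t u) N : B.
have H0 r s t : (N < r + s + t)%N -> H r s t = 0.
  move=> ltN; rewrite /H.
  (* The slots [u] have order 1 and the slot [m_s (u, .., u)] has order [s]. *)
  pose phi (b : bool) := if b then u else series_ext mA (nseq s u).
  have -> : nseq r u ++ series_ext mA (nseq s u) :: nseq t u =
      map phi (nseq r true ++ false :: nseq t true).
    by rewrite map_cat /= !map_nseq.
  rewrite (@series_ext_order _ _ _ _ _ (fun b : bool => if b then 1%N else s)) //.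
  - by rewrite scaler0.
  - case=> j /=; first by case: j.
    exact: series_ext_nseq_order.
  by rewrite map_cat sumn_cat /= !map_nseq !sumn_nseq /= !mul1n addnA.
transitivity (\sum_(0 <= n < N.+1) \sum_(0 <= r < n.+1)
    \sum_(0 <= s < (n - r).+1) H r s (n - r - s)%N).
  pose H' r k := \sum_(0 <= s < k.+1) H r s (k - s)%N.
  rewrite (@big_triangle_square _ H') => [|r k ltN]; last first.
    by rewrite /H' big1_seq // => s /andP[_]; rewrite mem_index_iota => lts;
      apply: H0; lia.
  rewrite -sum_alternating_pushforward; apply: eq_bigr => r _.
  rewrite big_triangle_square => [|s t ltN]; last by apply: H0; lia.
  rewrite exchange_big; apply: eq_bigr => t _; rewrite /H -scaler_sumr.
  congr (_ *: _).
  rewrite -(@series_ext_slot_sum _ _ _ F (nseq r u) (nseq t u)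
    (fun j => u j.+1)) //; last by move=> j lej; exact: uS.
  rewrite -series_ext_shift // /pushforward_term -addnS.
  by rewrite nseqD.
transitivity (\sum_(0 <= n < N.+1) \sum_(0 <= q < n.+1)
    \sum_(s <- words q (index_iota 0 n.+1) | sumn s == n)
      series_ext mB (map pushforward_term s) N).
  by apply: eq_bigr => n _; exact: morphism_identity_series.
transitivity (\sum_(0 <= n < N.+1) \sum_(0 <= q < N.+1)
    \sum_(s <- words q (index_iota 0 N.+1) | sumn s == n)
      series_ext mB (map pushforward_term s) N).
  apply: eq_big_nat => n /andP[_ ltn].
  (* A word longer than its sum has a letter 0, and [F] vanishes in arity 0. *)
  rewrite (@big_widen_zero _ _ n.+1 N.+1) // => [|q ltq].
    by apply: eq_bigr => q _; apply: big_words_widen => //; lia.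
  rewrite big1_seq // => s /andP[/eqP sn]; rewrite mem_words => /andP[/eqP sq _].
  have : 0%N \in s.
    apply: contraTT ltq => s0; rewrite -leqNgt -sq -sn size_le_sumn //.
    by apply/allP => k ks; rewrite lt0n; apply: contraNneq s0 => <-.
  case/splitPr=> s1 s2; rewrite map_cat /= series_ext_slot0 // => j.
  exact: pushforward_term_even.
rewrite exchange_big; apply: eq_big_nat => q _ /=.
transitivity (\sum_(s <- words q (index_iota 0 N.+1))
  series_ext mB (map pushforward_term s) N); last first.
  rewrite -(@series_ext_words _ _ _ mB _ _ pushforward_term pushforward [::]) //.
  by move=> j lej; exact: pushforwardE.
rewrite (exchange_big_dep xpredT) //=; apply: eq_bigr => s _.
rewrite (eq_bigl (fun n => n == sumn s)) => [|n]; last by rewrite eq_sym.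
rewrite big_nat1_eq; case: ifP => //= lts.
rewrite (@series_ext_order _ _ _ _ _ id) //; last by rewrite map_id; lia.
by move=> k j ltj; exact: series_ext_nseq_order.
Qed.

End Pushforward.

(** Both series solve the fixed point equation over [B], whose right side in
    order [w + 1] involves the solution up to order [w] only. *)
Lemma pushforward_even_tree_sum (K : fieldType) (A B : curvedAinf K)
    (F : ainfMorphism A B) w :
  (forall xs : seq A, ~~ odd (size xs) -> F xs = 0) ->
  pushforward F (even_tree_sum A) w = even_tree_sum B w.
Proof.
move=> F_even; elim/ltn_ind: w => -[_|w IH].
  by rewrite even_tree_sum0 /pushforward big_nat1; exact: pushforward_term_even.
rewrite (even_tree_sumS _ (leqnn w)) pushforwardS //; first last.
- exact: even_tree_sumS.
- exact: even_tree_sum0.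
- exact: even_deg_tree_sum.
by apply: eq_bigr => q _; apply: series_ext_congr_nseq => j lej; exact: IH.
Qed.

(** * Chern-Weil characters *)

(** The coefficient is a sum [S] over words of given length and sum.  Permuting
    the letters permutes the words, so [S] is also the sum of the permuted
    values for each [sigma]; adding over [sigma] gives [k! * Phi S = 0]. *)
Lemma odd_symmetrization_series (K : fieldType) (V : gradedVect K)
    (W Z : lmodType K) (Phi : {linear W -> Z}) (g : seq V -> W) (u : nat -> V) k w :
  [pchar K] =i pred0 -> odd_symmetrization_vanishes Phi g ->
  (forall j, even_deg (u j)) -> odd k -> (1 < k)%N ->
  Phi (series_ext g (nseq k u) w) = 0.
Proof.
move=> charK gsym u_even oddk k_gt1.
rewrite (series_ext_nseq _ _ _ (leqnn w)).
rewrite -(@big_tuple_words _ _ _ (fun s => sumn s == w) (fun s => g (map u s))).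
set S := \sum_(i | _) _.
pose permt (t : k.-tuple 'I_w.+1) (sigma : 'S_k) := [tuple tnth t (sigma j) | j < k].
have permtE (sigma : 'S_k) : S = \sum_(t : k.-tuple 'I_w.+1 | sumn (map val t) == w)
    g (map u (map val (permt t sigma))).
  rewrite /S (reindex (permt^~ sigma)) /=; last first.
    exists (permt^~ (sigma^-1)%g) => t _; apply: eq_from_tnth => j;
      by rewrite /permt !tnth_mktuple ?permK ?permKV.
  apply: eq_big => // t; congr (_ == _).
  rewrite !sumnE !big_map !big_tuple [RHS](reindex_inj (@perm_inj _ sigma)) /=.
  exact: eq_bigr.
have : \sum_(sigma : 'S_k) Phi S = 0.
  under eq_bigr => sigma _ do rewrite (permtE sigma) linear_sum.
  rewrite exchange_big big1 //= => t _.
  rewrite -[RHS](gsym k (fun j => u (tnth t j))) //.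
  by apply: eq_bigr => sigma _; rewrite /permt /= -!map_comp.
rewrite sumr_const card_Sn -scaler_nat => /eqP; rewrite scaler_eq0.
case/orP=> /eqP // fact0.
by move: ((pcharf0P K).1 charK k`!); rewrite fact0 eqxx (gtn_eqF (fact_gt0 k)).
Qed.

(** [Psi] sees only the linear term of the push-forward. *)
Lemma cw_char_morphism (K : fieldType) (X Y : chernWeil K) (Ff : cwMorphism X Y) n :
  [pchar K] =i pred0 ->
  (forall xs : seq (cw_alg X), ~~ odd (size xs) -> cwm_F Ff xs = 0) ->
  (0 < n)%N -> cwm_f Ff (cw_char X n) = cw_char Y n.
Proof.
move=> charK F_even n_gt0; rewrite !cw_charE //.
have -> : (2 * n).-1 = (2 * n - 2).+1 by lia.
move: (2 * n - 2)%N => w; set a := even_tree_sum (cw_alg X).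
have a_even j : even_deg (a j) by exact: even_deg_tree_sum.
rewrite -(pushforward_even_tree_sum _ F_even) -cwm_F1 // linear_sum.
rewrite !big_nat_recl //= big1 ?addr0 => [|k _].
  by rewrite pushforward_term_even // linear0 add0r /pushforward_term series_ext1.
have [oddk|evk] := boolP (odd k.+2); last by rewrite pushforward_term_even ?linear0.
exact: odd_symmetrization_series (cwm_sym Ff) _ _ _.
Qed.

Lemma pchar_ground_field (R : realType) k : [pchar ground_field R k] =i pred0.
Proof. by case: k; exact: pchar_num. Qed.

Theorem proposition4p9 (R : realType) (k : scalars)
    (X Y : chernWeil (ground_field R k)) (Ff : cwMorphism X Y)
    (F_even : forall xs : seq (cw_alg X), ~~ odd (size xs) -> cwm_F Ff xs = 0%R)
    (n : nat) (hn : (1 <= n)%N) :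
  cwm_f Ff (cw_char X n) = cw_char Y n.
Proof. exact: cw_char_morphism (pchar_ground_field R k) F_even hn. Qed.
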